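(* Let $\mathrm{k}$ be an infinite field and $\mathcal{A}$ a finite-dimensional unital associative $\mathrm{k}$-algebra. The following are equivalent: (1) $\mathcal{A}$ has only finitely many subalgebras. (2) There exist finite field extensions $L_1,\ldots,L_n$ of $\mathrm{k}$, each generated over $\mathrm{k}$ by one element, and integers $\delta\in\{0,1\}$, $m\in\{2,3\}$ such that $\mathcal{A}\cong L_1\times\cdots\times L_n\times(\mathrm{k}[T]/(T^m))^{\delta}$ as $\mathrm{k}$-algebras. (3) There exists $g\in\mathcal{A}$ with $\mathcal{A}=\mathrm{k}[g]$ such that the minimal polynomial of $g$ has the form $\mu_g=P_1\cdots P_nQ^{m\delta}$, where $P_1,\ldots,P_n,Q$ are pairwise distinct irreducible polynomials in $\mathrm{k}[T]$, $\delta\in\{0,1\}$, $m\in\{2,3\}$ and $\deg Q=1$.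
   Context: Subalgebras are unital, i.e. contain $1$. $\mathrm{k}[g]$ denotes the subalgebra generated by $g$.
   Formalization: In (3) the irreducible polynomials P_1,…,P_n,Q are taken monic; otherwise ''pairwise distinct'' allows scalar multiples, e.g. (cT)(c^{-1}T)T^2=T^4, and k[T]/(T^4) has infinitely many subalgebras. The algebra is assumed nonzero (trivial degenerate case excluded). *)

(* Defs.v *)
From HB Require Import structures.
From mathcomp Require Import all_boot all_order all_algebra all_field.
Set Implicit Arguments. Unset Strict Implicit. Unset Printing Implicit Defensive.
Import GRing.Theory.
Local Open Scope ring_scope.

Definition infinite_type (T : eqType) : Prop :=
  forall s : seq T, exists x, x \notin s.

Section Defs.
Variable k : fieldType.

Definition is_subalgebra (A : falgType k) (U : {vspace A}) : bool :=
  (1 \in U) && (U * U <= U)%VS.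

Definition finitely_many_subalgebras (A : falgType k) : Prop :=
  exists s : seq {vspace A}, forall U : {vspace A}, is_subalgebra U -> U \in s.

Definition generated_by (A : falgType k) (g : A) : Prop :=
  <<1; g>>%VS = fullv.

Definition simple_ext (L : fieldExtType k) : Prop :=
  exists x : L, generated_by x.

Definition is_minpoly (A : falgType k) (g : A) (mu : {poly k}) : Prop :=
  [/\ mu \is monic, horner_alg g mu = 0 &
      forall q : {poly k}, horner_alg g q = 0 -> mu %| q].

(* The k-algebra morphism x |-> (f_1 x, ..., f_n x) from A to L_1 x ... x L_n
   (componentwise product algebra) is bijective. *)
Definition iso_prod (A : falgType k) (n : nat) (L : 'I_n -> fieldExtType k)
    (f : forall i, {lrmorphism A -> L i}) : Prop :=
  (forall x y : A, (forall i, f i x = f i y) -> x = y) /\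
  (forall y : forall i, L i, exists x : A, forall i, f i x = y i).

Definition iso_prod_ext (A : falgType k) (n : nat) (L : 'I_n -> fieldExtType k)
    (B : lalgType k) (f : forall i, {lrmorphism A -> L i})
    (h : {lrmorphism A -> B}) : Prop :=
  (forall x y : A, (forall i, f i x = f i y) -> h x = h y -> x = y) /\
  (forall (y : forall i, L i) (z : B),
      exists x : A, (forall i, f i x = y i) /\ h x = z).

End Defs.

(* Main.v *)
Require Import Defs.
From HB Require Import structures.
From mathcomp Require Import all_boot all_order all_algebra all_field.
From mathcomp Require Import ring.
From Stdlib Require Import Classical.
Import GRing.Theory.
Local Open Scope ring_scope.
Set Implicit Arguments.
Unset Strict Implicit.

(* (1) => (3): an element g with k[g] of maximal dimension generates A, by
   pigeonhole on the algebras k[g + c h].  If E^2 divides the minimal polynomial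
   mu = D E of g and deg E > 1, then u = D(g) and v = g u span a plane with zero
   multiplication and the algebras k + k (u + c v) are pairwise distinct; so
   deg E <= 1 whenever E^2 divides mu, which forces the stated factorization.
   (2) <=> (3): Chinese remainders, after translating the generators of the L_i
   so that their minimal polynomials become distinct and different from T.
   (2) => (1): let A = k[g] map to fields F_i with joint kernel N, and let B be a
   subalgebra containing N.  As B / N is reduced, A retracts onto B as a
   B-module modulo N; hence B is recovered, as in Steinitz' proof, from the
   ideals of the F_i[T] generated by the q(T) - q(g) with q(g) in B.  These are
   generated by divisors of mu, so there are finitely many B.  When there is a
   factor k[T]/(T^m), a subalgebra B is determined by B + N and by the
   intersection of B and N, and the latter is 0, (T^2) or (T). *)

(** * Finiteness and polynomials *)

(** Each code in [l] accounts for at most one element, so induction on [l] lists them all. The code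
    is a relation, so that it may merely exist, like the ideal generators used further down. *)
Lemma finite_of_code (X T : eqType) (P : X -> Prop) (R : X -> T -> Prop)
    (l : seq T) :
  (forall x, P x -> exists2 t, t \in l & R x t) ->
  (forall x y t, P x -> P y -> R x t -> R y t -> x = y) ->
  exists s : seq X, forall x, P x -> x \in s.
Proof.
move=> Pl Rinj.
have [s sP] : exists s : seq X,
    forall x t, P x -> t \in l -> R x t -> x \in s.
  elim: l {Pl} => [|t l [s sP]]; first by exists [::].
  have [[x [Px Rxt]]|nex] := classic (exists x, P x /\ R x t).
    exists (x :: s) => y t' Py; rewrite !inE => /orP[/eqP->|t'l] Ryt.
      by rewrite (Rinj _ _ _ Py Px Ryt Rxt) eqxx.
    by rewrite (sP y t') ?orbT.
  exists s => y t' Py; rewrite inE => /orP[/eqP->|t'l] Ryt; last exact: sP Ryt.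
  by case: nex; exists y.
by exists s => x Px; have [t tl Rxt] := Pl x Px; apply: sP tl Rxt.
Qed.

Lemma infinite_uniq_seq (T : eqType) (n : nat) :
  infinite_type T -> exists2 s : seq T, uniq s & size s = n.
Proof.
move=> Tinf; elim: n => [|n [s us <-]]; first by exists [::].
by have [x xs] := Tinf s; exists (x :: s) => //=; rewrite xs.
Qed.

Lemma infinite_pigeonhole (T U : eqType) (f : T -> U) (s : seq U) :
  infinite_type T -> (forall x, f x \in s) -> exists x y, x != y /\ f x = f y.
Proof.
move=> Tinf fs; have [r ur sz_r] := infinite_uniq_seq (size s).+1 Tinf.
apply: NNPP => nex.
have : (size (map f r) <= size s)%N.
  apply: uniq_leq_size => [|_ /mapP[x _ ->] //].
  rewrite map_inj_uniq // => x y fxy; apply/eqP; apply: contraT => xy.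
  by case: nex; exists x, y.
by rewrite size_map sz_r ltnn.
Qed.

Section Polynomials.
Variable F : fieldType.
Implicit Types p q d : {poly F}.

Lemma monic_normalize p : p != 0 -> (lead_coef p)^-1 *: p \is monic.
Proof. by move=> p0; rewrite monicE lead_coefZ mulVf ?lead_coef_eq0. Qed.

(** A nonzero element of least degree divides all others: as long as [p] fails to divide some [q] in
    [I], the remainder [q %% p] is a smaller nonzero element of [I]. *)
Lemma ideal_principal (I : {poly F} -> Prop) p :
  (forall a b, I a -> I b -> I (a + b)) -> (forall r a, I a -> I (r * a)) ->
  p != 0 -> I p -> exists d, [/\ d \is monic, I d & forall q, I q -> d %| q].
Proof.
move=> ID IM; have [n] := ubnP (size p); elim: n p => // n IHn p.
rewrite ltnS => le_pn p0 Ip.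
have [[q [Iq ndv]]|ndv] := classic (exists q, I q /\ ~~ (p %| q)).
  apply: (IHn (q %% p)) => //; first by apply: leq_trans le_pn; rewrite ltn_modp.
  have -> : q %% p = q + (- (q %/ p)) * p.
    by rewrite {2}(divp_eq q p) mulNr addrC addrA addNr add0r.
  by apply: (ID _ _ Iq); apply: IM.
have lp0 : (lead_coef p)^-1 != 0 by rewrite invr_eq0 lead_coef_eq0.
exists ((lead_coef p)^-1 *: p); split; first exact: monic_normalize.
  by rewrite -mul_polyC; apply: IM.
move=> q Iq; rewrite dvdpZl //; apply: contraT => npq.
by case: ndv; exists q.
Qed.

(** Induction on the degree. If [p = a * b] with smaller factors, a monic divisor [d] is [gcdp d a],
    made monic, times a monic divisor of [b]; without such factors, [d] is 1 or [p] made monic. *)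
Lemma monic_divisors_finite p : p != 0 ->
  exists s : seq {poly F}, forall d, d \is monic -> d %| p -> d \in s.
Proof.
have [n] := ubnP (size p); elim: n p => // n IHn p.
rewrite ltnS => le_pn p0.
have [[a [b [pE lt_a lt_b]]]|irr] := classic (exists a b,
  [/\ p = a * b, (size a < size p)%N & (size b < size p)%N]).
  move: p0; rewrite pE mulf_eq0 negb_or => /andP[a0 b0].
  have [sa saP] := IHn a (leq_trans lt_a le_pn) a0.
  have [sb sbP] := IHn b (leq_trans lt_b le_pn) b0.
  exists [seq x * y | x <- sa, y <- sb] => d mond dab.
  have d0 := monic_neq0 mond.
  set g := (lead_coef (gcdp d a))^-1 *: gcdp d a.
  have g0 : gcdp d a != 0 by rewrite gcdp_eq0 negb_and d0.
  have lg0 : (lead_coef (gcdp d a))^-1 != 0 by rewrite invr_eq0 lead_coef_eq0.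
  have mong : g \is monic by apply: monic_normalize.
  have /dvdpP[e dE] : g %| d by rewrite dvdpZl // dvdp_gcdl.
  have mone : e \is monic by rewrite -(monicMr e mong) -dE.
  apply/allpairsP; exists (g, e); split => /=; last by rewrite mulrC.
    by apply: saP => //; rewrite dvdpZl // dvdp_gcdr.
  (* After multiplication by [g] the claim is, up to a scalar, [d %| b * gcdp d a]; Bezout expands
     the right side, and [d] divides [a * b]. *)
  apply: sbP => //; rewrite -(dvdp_mul2r e b (monic_neq0 mong)) -dE /g -scalerAr.
  rewrite dvdpZr //; have [[u v] /= uvE] := Bezoutp d a.
  have -> : (d %| b * gcdp d a) = (d %| b * (u * d + v * a)).
    by apply: eqp_dvdr; apply: eqp_mull; rewrite eqp_sym.
  rewrite mulrDr dvdp_add //; first by do 2!apply: dvdp_mull.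
  by rewrite mulrCA dvdp_mull // mulrC.
exists [:: 1; (lead_coef p)^-1 *: p] => d mond /[dup] dp /dvdpP[c pE].
have lp0 : (lead_coef p)^-1 != 0 by rewrite invr_eq0 lead_coef_eq0.
have [lt_d|le_d] := ltnP (size d) (size p); last first.
  rewrite !inE; apply/orP; right.
  rewrite -eqp_monic ?monic_normalize //.
  rewrite eqp_sym (eqp_trans (eqp_scale _ lp0)) // eqp_sym -dvdp_size_eqp //.
  by rewrite eqn_leq le_d dvdp_leq.
have [lt_c|le_c] := ltnP (size c) (size p).
  by case: irr; exists c, d.
rewrite !inE; apply/orP; left; rewrite -eqp_monic ?monic1 // -size_poly_eq1.
have c0 : c != 0 by apply: contraNneq p0 => c0; rewrite pE c0 mul0r.
have := size_mul c0 (monic_neq0 mond); rewrite -pE => szE.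
have d1 : (0 < size d)%N by rewrite size_poly_gt0 monic_neq0.
rewrite szE in le_c.
move: le_c d1; case: (size d) => // m; rewrite addnS /= -{2}[size c]addn0.
by rewrite leq_add2l leqn0 => /eqP->.
Qed.

Lemma coprimep_prodr (I : Type) (r : seq I) (P : pred I)
    (D : I -> {poly F}) p :
  (forall i, P i -> coprimep p (D i)) -> coprimep p (\prod_(i <- r | P i) D i).
Proof.
move=> cop; apply: (big_ind (fun q => coprimep p q)) => //.
  exact: coprimep1.
by move=> a b; rewrite coprimepMr => -> ->.
Qed.

Lemma prod_dvdp (I : eqType) (r : seq I) (D : I -> {poly F}) p :
  uniq r -> {in r &, forall i j, i != j -> coprimep (D i) (D j)} ->
  {in r, forall i, D i %| p} -> \prod_(i <- r) D i %| p.
Proof.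
elim: r => [|i r IHr] /=; first by rewrite big_nil dvd1p.
move=> /andP[ir ur] cop dvp; rewrite big_cons Gauss_dvdp.
  rewrite dvp ?mem_head // IHr // => [j l jr lr|j jr].
    by apply: cop; rewrite inE ?jr ?lr orbT.
  by apply: dvp; rewrite inE jr orbT.
rewrite big_seq; apply: coprimep_prodr => j jr.
by apply: cop; rewrite ?inE ?eqxx ?jr ?orbT //; apply: contraNneq ir => ->.
Qed.

(** By Bezout, [e i] is 1 modulo [D i] and 0 modulo every other [D j]; the sum of the [e i * t i] is
    a solution. *)
Lemma chinese_poly (I : finType) (D t : I -> {poly F}) :
  (forall i j, i != j -> coprimep (D i) (D j)) ->
  exists p, forall i, D i %| p - t i.
Proof.
move=> cop.
have /fin_all_exists[e eP] i : exists e,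
    D i %| e - 1 /\ forall j, j != i -> D j %| e.
  have /Bezout_eq1_coprimepP[[u v] /= uvE] :
      coprimep (D i) (\prod_(j | j != i) D j).
    by apply: coprimep_prodr => j ji; apply: cop; rewrite eq_sym.
  exists (v * \prod_(j | j != i) D j); split.
    by rewrite -[X in _ - X]uvE opprD addrCA subrr addr0 dvdpNr dvdp_mull.
  by move=> j ji; rewrite dvdp_mull // (bigD1 j) //= dvdp_mulr.
exists (\sum_i e i * t i) => i; rewrite (bigD1 i) //= -addrA addrC -addrA.
rewrite -[X in - X + _]mul1r -mulNr -mulrDl addrC dvdp_add //.
  by rewrite dvdp_mulr // addrC; case: (eP i).
apply: (big_ind (fun q => D i %| q)) => [|a b|j ji]; first exact: dvdp0.
  exact: dvdp_add.
by rewrite dvdp_mulr //; case: (eP j) => _ -> //; rewrite eq_sym.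
Qed.

Lemma irreducible_monic_coprime p q :
  p \is monic -> irreducible_poly p -> q \is monic -> irreducible_poly q ->
  p != q -> coprimep p q.
Proof.
move=> mp ip mq [_ iq] pq; rewrite irreducible_poly_coprime //.
apply: contra pq => pdq; rewrite -eqp_monic //; apply: iq => //.
by case: ip => p1 _; rewrite gtn_eqF.
Qed.

Lemma irreducible_size2 p : size p = 2%N -> irreducible_poly p.
Proof.
move=> szp; split=> [|q q1 qp]; first by rewrite szp.
have p0 : p != 0 by rewrite -size_poly_gt0 szp.
rewrite -dvdp_size_eqp // eqn_leq dvdp_leq //= szp.
by rewrite ltn_neqAle eq_sym q1 size_poly_gt0 (dvdpN0 qp).
Qed.

Lemma monic_factorization p : p \is monic ->
  exists2 s : seq {poly F}, p = \prod_(q <- s) q &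
    forall q, q \in s -> q \is monic /\ irreducible_poly q.
Proof.
have [n] := ubnP (size p); elim: n p => // n IHn p.
rewrite ltnS => le_pn mp.
have [p1|p1] := leqP (size p) 1.
  exists [::] => //; rewrite big_nil; apply/eqP.
  rewrite -eqp_monic ?monic1 // -size_poly_eq1 eqn_leq p1.
  by rewrite size_poly_gt0 monic_neq0.
have [irr|nirr] := classic (irreducible_poly p).
  exists [:: p]; first by rewrite big_seq1.
  by move=> q; rewrite inE => /eqP->.
have [d [d1 dp ndp]] : exists d, [/\ size d != 1, d %| p & ~~ (d %= p)].
  apply: NNPP => nex; apply: nirr; split=> // d d1 dp.
  by apply: contraT => ndp; case: nex; exists d.
have p0 := monic_neq0 mp.
have d0 : d != 0 := dvdpN0 dp p0.
have mg := monic_normalize d0; set g := _ *: d in mg.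
have ld0 : (lead_coef d)^-1 != 0 by rewrite invr_eq0 lead_coef_eq0.
have szg : size g = size d by rewrite size_scale.
have gp : g %| p by rewrite dvdpZl.
have /dvdpP[c pE] := gp.
have mc : c \is monic by rewrite -(monicMr c mg) -pE.
have ltg : (size g < size p)%N.
  rewrite ltn_neqAle dvdp_leq // andbT szg; apply: contra ndp.
  by rewrite dvdp_size_eqp.
have g1 : (1 < size g)%N.
  by rewrite ltn_neqAle szg eq_sym d1 size_poly_gt0.
have ltc : (size c < size p)%N.
  rewrite pE size_mul ?monic_neq0 // -(ltn_predK g1) addnS /=.
  by rewrite -[X in (X < _)%N]addn0 ltn_add2l -ltnS (ltn_predK g1).
have [s1 E1 P1] := IHn g (leq_trans ltg le_pn) mg.
have [s2 E2 P2] := IHn c (leq_trans ltc le_pn) mc.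
exists (s1 ++ s2); first by rewrite big_cat /= -E1 -E2 mulrC.
by move=> q; rewrite mem_cat => /orP[/P1|/P2].
Qed.

Lemma prod_count_mem q (s : seq {poly F}) : \prod_(p <- s) p =
  q ^+ count_mem q s * \prod_(p <- [seq p <- s | p != q]) p.
Proof.
rewrite (bigID (pred1 q)) /= big_filter; congr (_ * _).
rewrite (eq_bigr (fun=> q)) => [|p /eqP //].
by rewrite big_const_seq iter_mulr_1.
Qed.

Lemma repeated_mem (s : seq {poly F}) : ~~ uniq s ->
  exists2 q, q \in s & (1 < count_mem q s)%N.
Proof.
move=> nus; apply: NNPP => nex; case/negP: nus; apply: count_mem_uniq => q.
have [qs|/count_memPn //] := boolP (q \in s).
apply/eqP; rewrite eqn_leq -has_count has_pred1 qs andbT leqNgt.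
by apply/negP => q2; case: nex; exists q.
Qed.

End Polynomials.

(** * Algebras generated by one element *)

Section Generation.
Variable k : fieldType.

Lemma horner_alg_fun (A B : algType k) (f : {lrmorphism A -> B}) (g : A)
    (p : {poly k}) :
  f (horner_alg g p) = horner_alg (f g) p.
Proof.
elim/poly_ind: p => [|p c IHp]; first by rewrite !rmorph0.
by rewrite !(rmorphD, rmorphM) /= !horner_algX !horner_algC rmorph_alg IHp.
Qed.

Lemma horner_alg_comp (A : algType k) (g : A) (p q : {poly k}) :
  horner_alg g (p \Po q) = horner_alg (horner_alg g q) p.
Proof.
elim/poly_ind: p => [|p c IHp]; first by rewrite comp_poly0 !rmorph0.
rewrite comp_polyD comp_polyM comp_polyX comp_polyC.
by rewrite !(rmorphD, rmorphM) /= !horner_algX !horner_algC IHp.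
Qed.

Lemma horner_alg_dvdp (A : algType k) (g : A) (p q : {poly k}) :
  p %| q -> horner_alg g p = 0 -> horner_alg g q = 0.
Proof. by case/dvdpP=> r ->; rewrite rmorphM /= => ->; rewrite mulr0. Qed.

Lemma horner_algZ (A : algType k) (g : A) a (p : {poly k}) :
  horner_alg g (a *: p) = a *: horner_alg g p.
Proof. by rewrite -mul_polyC rmorphM /= horner_algC mulr_algl. Qed.

Section OneAlgebra.
Variable A : falgType k.
Implicit Types (g x : A) (U : {vspace A}) (p q : {poly k}).

Lemma subalg1 U : is_subalgebra U -> 1 \in U.
Proof. by case/andP. Qed.

Lemma subalgM U x y : is_subalgebra U -> x \in U -> y \in U -> x * y \in U.
Proof. by move=> /andP[_ /subvP sU] xU yU; apply/sU/memv_mul. Qed.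

Lemma subalg_alg U a : is_subalgebra U -> a%:A \in U.
Proof. by move=> sU; apply/memvZ/subalg1. Qed.

Lemma subalg_horner U x p : is_subalgebra U -> x \in U -> horner_alg x p \in U.
Proof.
move=> sU xU; elim/poly_ind: p => [|p c IHp]; first by rewrite rmorph0 mem0v.
rewrite rmorphD rmorphM /= horner_algX horner_algC memvD ?subalg_alg //.
exact: subalgM.
Qed.

(** The source consists of the polynomials of size at most [N]; it has finite dimension, so
    dimensions can be counted and images are subspaces of [A]. *)
Definition horner_npoly N g (p : {poly_N k}) : A := horner_alg g p.

Lemma horner_npoly_linear N g : linear (@horner_npoly N g).
Proof.
move=> a p q; rewrite /horner_npoly.
have -> : polyn (a *: p + q) = a *: polyn p + polyn q by [].
by rewrite rmorphD /= horner_algZ.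
Qed.

HB.instance Definition _ N g :=
  GRing.isLinear.Build k {poly_N k} A _ (@horner_npoly N g)
    (@horner_npoly_linear N g).

Definition horner_lfun N g : 'Hom({poly_N k}, A) := linfun (@horner_npoly N g).

Lemma horner_lfunE N g (p : {poly_N k}) : horner_lfun N g p = horner_alg g p.
Proof. exact: lfunE. Qed.

Lemma ex_annihilator g : exists2 p, p != 0 & horner_alg g p = 0.
Proof.
(* One more coefficient than the dimension of [A], so evaluation cannot be injective. *)
pose N := (\dim {: A}).+1; pose f := horner_lfun N g.
have lker_neq0 : lker f != 0%VS.
  rewrite -dimv_eq0; apply/eqP => ker0.
  have := limg_ker_dim f fullv; rewrite capfv ker0 add0n dim_polyn => dimf.
  have := dimvS (subvf (limg f)); rewrite dimf.
  by rewrite /N ltnn.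
have := memv_pick (lker f); rewrite memv_ker horner_lfunE => /eqP fp0.
exists (polyn (vpick (lker f))) => //.
by apply: contraNneq lker_neq0 => p0; rewrite -vpick0; apply/eqP/val_inj.
Qed.

Lemma ex_minpoly g : exists mu, is_minpoly g mu.
Proof.
have [p p0 pg] := ex_annihilator g.
have [] := @ideal_principal _ (fun q => horner_alg g q = 0) p => //.
- by move=> a b a0 b0; rewrite rmorphD /= a0 b0 addr0.
- by move=> r a a0; rewrite rmorphM /= a0 mulr0.
- by move=> mu [mon mug mindiv]; exists mu.
Qed.

Lemma minpoly_eq0P g mu p :
  is_minpoly g mu -> horner_alg g p = 0 <-> mu %| p.
Proof.
by case=> _ mu0 mudiv; split=> [/mudiv //|/horner_alg_dvdp]; apply.
Qed.

Lemma generated_byP g :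
  generated_by g <-> forall x, exists p, horner_alg g p = x.
Proof.
split=> [geng x|Hg].
  have [mu [mon mug _]] := ex_minpoly g.
  (* Division by [mu] puts every polynomial in [g] into [W]; being stable under multiplication by 1
     and [g], [W] then contains [<<1; g>>]. *)
  pose W := limg (horner_lfun (size mu).-1 g).
  have mem_W p : horner_alg g p \in W.
    have sz : (size (p %% mu)%R <= (size mu).-1)%N.
      have mu1 : (0 < size mu)%N by rewrite size_poly_gt0 monic_neq0.
      by rewrite -ltnS (prednK mu1) ltn_modp monic_neq0.
    apply/memv_imgP; exists (npolyp _ (p %% mu)); first exact: memvf.
    rewrite horner_lfunE npolypK // {1}(divp_eq p mu) rmorphD rmorphM /= mug.
    by rewrite mulr0 add0r.
  have : x \in W.
    suff /subvP : (<<1; g>> <= W)%VS by rewrite geng; apply; apply: memvf.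
    apply: agenv_sub_modl; first by rewrite -memvE -(rmorph1 (horner_alg g)) mem_W.
    apply/prodvP => u w /memv_addP[_ /vlineP[a ->] [_ /vlineP[b ->] ->]].
    case/memv_imgP=> p _ ->; rewrite horner_lfunE.
    have -> : a%:A + b *: g = horner_alg g (a%:P + b *: 'X).
      by rewrite rmorphD /= horner_algZ horner_algX horner_algC.
    by rewrite -rmorphM mem_W.
  by case/memv_imgP=> p _; rewrite horner_lfunE => ->; exists (polyn p).
apply/eqP; rewrite eqEsubv subvf /=; apply/subvP => x _.
have [p <-] := Hg x; apply: subalg_horner; last exact: memv_adjoin.
by rewrite /is_subalgebra agenvM subvv memvE sub1_agenv.
Qed.

Lemma generated_commute g x y : generated_by g -> x * y = y * x.
Proof.
move=> /generated_byP Hg; have [p <-] := Hg x; have [q <-] := Hg y.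
by rewrite -!rmorphM mulrC.
Qed.

(* If p(x) = 0 with p = q X^j and q(0) <> 0, a Bezout relation between q and
   X^(j+1) yields the idempotent of k[x] cutting out the part where x is
   invertible. *)
Lemma fitting_idempotent x : exists v j, let w := horner_alg x v * x ^+ j.+1 in
  w * w = w /\ x ^+ j.+1 * w = x ^+ j.+1.
Proof.
have [p p0 px0] := ex_annihilator x.
have [j [q]] := multiplicity_XsubC p 0.
rewrite p0 subr0 /= => q0 pE.
have /Bezout_eq1_coprimepP[[u v] /= uvE] : coprimep q 'X^(j.+1).
  by rewrite coprimep_expr // coprimepX.
(* The exponent is [j.+1] so that it stays positive when [j = 0]: the idempotent is then always a
   multiple of [x]. *)
exists v, j.
have wE : horner_alg x v * x ^+ j.+1 = horner_alg x (v * 'X^(j.+1)).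
  by rewrite rmorphM rmorphXn /= horner_algX.
have XE : x ^+ j.+1 = horner_alg x 'X^(j.+1) by rewrite rmorphXn /= horner_algX.
rewrite /= wE XE -!rmorphM.
have kill r : horner_alg x (r * ('X^(j.+1) * (u * q))) = 0.
  have -> : r * ('X^(j.+1) * (u * q)) = (r * 'X * u) * p.
    by rewrite pE exprS; ring.
  by rewrite rmorphM /= px0 mulr0.
have E a : horner_alg x ('X^(j.+1) * a * (v * 'X^(j.+1))) =
           horner_alg x ('X^(j.+1) * a).
  have vE : v * 'X^(j.+1) = 1 - u * q by rewrite -uvE; ring.
  have -> : 'X^(j.+1) * a * (v * 'X^(j.+1)) =
            'X^(j.+1) * a + (- a) * ('X^(j.+1) * (u * q)) by rewrite vE; ring.
  by rewrite rmorphD /= kill addr0.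
split; first by have := E v; rewrite [v * _]mulrC.
by have := E 1; rewrite mulr1.
Qed.

End OneAlgebra.
End Generation.

(** * Algebras with finitely many subalgebras *)

Section FiniteSubalgebras.
Variables (k : fieldType) (A : falgType k).
Hypotheses (k_infinite : infinite_type k)
  (A_finite : finitely_many_subalgebras A).
Implicit Types (g : A) (U : {vspace A}).

Lemma subalg_adjoin_sub U g : is_subalgebra U -> g \in U -> (<<1; g>> <= U)%VS.
Proof.
move=> /andP[U1 sU] gU; apply: agenv_sub_modl; first by rewrite -memvE.
apply: subv_trans sU; apply: prodvSl.
by rewrite subv_add -!memvE U1.
Qed.

Lemma adjoin_subalg g : is_subalgebra <<1; g>>%VS.
Proof. by rewrite /is_subalgebra agenvM subvv memvE sub1_agenv. Qed.

(* An element g with dim k[g] maximal generates: for h outside k[g], two of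
   the algebras k[g + c h] coincide, and they contain both g and h. *)
Lemma ex_generator : exists g, generated_by g.
Proof.
suff main n g : (\dim {: A} <= \dim <<1; g>> + n)%N ->
    exists g', @generated_by k A g'.
  exact: (main (\dim {: A}) 0 (leq_addl _ _)).
elim: n g => [|n IHn] g le_n.
  exists g; apply/eqP; rewrite eqEdim subvf /=.
  by rewrite addn0 in le_n.
have [gen|] := boolP (fullv <= <<1; g>>)%VS.
  by exists g; apply/eqP; rewrite eqEsubv subvf.
case/subvPn=> h _ hg.
have [s sP] := A_finite.
have [c [d [cd fcd]]] := infinite_pigeonhole (f := fun c => <<1; g + c *: h>>%VS)
  k_infinite (fun c => sP _ (adjoin_subalg _)).
apply: (IHn (g + c *: h)); apply: leq_trans le_n _.
rewrite addnS -addSn leq_add2r.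
set U := <<1; _>>%VS in fcd *.
have Uc : g + c *: h \in U by apply: memv_adjoin.
have Ud : g + d *: h \in U by rewrite fcd; apply: memv_adjoin.
have hU : h \in U.
  have := memvB Uc Ud; rewrite opprD addrACA subrr add0r -scalerBl.
  by move/(memvZ (c - d)^-1); rewrite scalerA mulVf ?scale1r // subr_eq0.
have gU : g \in U by have := memvB Uc (memvZ c hU); rewrite addrK.
have sU : (<<1; g>> <= U)%VS.
  by apply: subalg_adjoin_sub gU; apply: adjoin_subalg.
rewrite ltn_neqAle dimvS // andbT.
by rewrite (dimv_leqif_eq sU); apply: contraNneq hg => ->.
Qed.

(** With [mu = r * E ^+ 2] and [D = r * E], any multiple of [D(g)] has square zero, hence spans a
    subalgebra together with 1. If [E] had degree at least 2, the elements [D(g) (1 + c g)] would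
    give infinitely many subalgebras. *)
Lemma minpoly_square_factor g (mu E : {poly k}) :
  is_minpoly g mu -> E ^+ 2 %| mu -> (size E <= 2)%N.
Proof.
move=> gmu /dvdpP[r muE]; rewrite leqNgt; apply/negP => E3.
have mu0 : mu != 0 by apply: monic_neq0; case: gmu.
pose D := r * E; have muDE : mu = D * E by rewrite muE /D expr2 mulrA.
have [D0 E0] : D != 0 /\ E != 0.
  by apply/andP; rewrite -negb_or -mulf_eq0 -muDE.
have szD : (2 < size D)%N.
  by apply: leq_trans E3 _; apply: dvdp_leq => //; apply: dvdp_mull.
pose w c := horner_alg g (D * (1 + c *: 'X)).
have ww c : w c * w c = 0.
  rewrite /w -rmorphM /=; apply/(minpoly_eq0P _ gmu).
  have -> : D * (1 + c *: 'X) * (D * (1 + c *: 'X)) =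
            r * (1 + c *: 'X) ^+ 2 * mu by rewrite muE /D; ring.
  exact: dvdp_mull.
pose S c := (1 + <[w c]>)%VS.
have subS c : is_subalgebra (S c).
  apply/andP; split; first by rewrite memvE addvSl.
  rewrite prodvDl !prodvDr !prodv1 prod1v prodv_line ww !subv_add addvSl.
  by rewrite addvSr -memvE mem0v.
have [s sP] := A_finite.
have [c [d [cd Scd]]] := infinite_pigeonhole k_infinite (fun c => sP _ (subS c)).
have /memv_addP[_ /vlineP[a ->] [_ /vlineP[b ->] wd]] : w d \in S c.
  by rewrite Scd memvE addvSr.
have mudvd : mu %| D * (1 + d *: 'X) - (a%:P + b *: (D * (1 + c *: 'X))).
  apply/(minpoly_eq0P _ gmu); rewrite rmorphB rmorphD /= horner_algZ.
  by rewrite horner_algC -/(w _) -/(w c) wd subrr.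
(* All other terms are multiples of [D], whose degree is at least 2, so [D] divides the constant
   [a]. *)
have a0 : a = 0.
  apply: contraTeq szD => a0.
  have : D %| a%:P.
    have Dmu : D %| mu by rewrite muDE dvdp_mulr.
    have := dvdp_trans Dmu mudvd.
    have DD q : D %| D * q by rewrite dvdp_mulr.
    by rewrite (dvdp_subr _ (DD _)) dvdp_addl // -mul_polyC dvdp_mull.
  move/dvdp_leq; rewrite polyC_eq0 size_polyC a0 => /(_ isT) le1.
  by rewrite -leqNgt (leq_trans le1).
move: mudvd; rewrite a0 polyC0 add0r.
have -> : D * (1 + d *: 'X) - b *: (D * (1 + c *: 'X)) =
          D * ((1 - b)%:P + (d - b * c) *: 'X).
  by rewrite -!mul_polyC; ring.
rewrite muDE dvdp_mul2l //; set t := _ + _ => Et.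
(* [E] has degree at least 2 and [t] at most 1. The two coefficients of [t] then give [b = 1] and
   [d = c]. *)
have t0 : t = 0.
  apply: contraTeq Et => t0; rewrite gtNdvdp //.
  apply: leq_ltn_trans E3; rewrite /t addrC -mul_polyC size_MXaddC.
  by case: ifP => // _; rewrite ltnS size_polyC_leq1.
have := congr1 (fun p : {poly k} => p`_0) t0.
have := congr1 (fun p : {poly k} => p`_1) t0.
rewrite /t !coefD !coefC !coefZ !coefX /= ?coef0 mulr1 mulr0 add0r addr0.
move=> /eqP; rewrite subr_eq0 => /eqP dE /eqP; rewrite subr_eq0 => /eqP b1.
by rewrite dE -b1 mul1r eqxx in cd.
Qed.

End FiniteSubalgebras.

(** * Factorizations in which only linear polynomials occur squared *)

Section FactorShape.
Variable k : fieldType.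
Hypothesis k_infinite : infinite_type k.
Variable mu : {poly k}.
Hypothesis mon_mu : mu \is monic.
Hypothesis square_factor : forall E : {poly k}, E ^+ 2 %| mu -> (size E <= 2)%N.

(** If the irreducible factors repeat, let [Q] be a repeated one. The hypothesis on squares, applied
    to [Q], makes [Q] linear; applied to [P * Q], it excludes a second repeated factor [P]; applied
    to [Q ^+ 2], it bounds the multiplicity by 3. *)
Lemma minpoly_shape : exists (Ps : seq {poly k}) (Q : {poly k}) (delta m : nat),
   [/\ (forall P, P \in Ps -> P \is monic /\ irreducible_poly P),
       [/\ Q \is monic, irreducible_poly Q & size Q = 2%N],
       uniq (Q :: Ps),
       (delta <= 1)%N /\ ((m == 2)%N || (m == 3)%N) &
       mu = \prod_(P <- Ps) P * Q ^+ (m * delta)].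
Proof.
have mu0 := monic_neq0 mon_mu.
have [S muE irrS] := monic_factorization mon_mu.
have [uS|nuS] := boolP (uniq S).
  (* Even with [delta = 0], [Q] has to differ from all factors, so [c] avoids their negated constant
     terms. *)
  have [c cS] := k_infinite [seq - P`_0 | P : {poly k} <- S].
  exists S, ('X - c%:P), 0%N, 2%N; split => //=; last first.
  - by rewrite muE muln0 expr0 mulr1.
  - rewrite uS andbT; apply: contra cS => cS.
    apply/mapP; exists ('X - c%:P) => //.
    by rewrite coefB coefX coefC /= sub0r opprK.
  - by split; [exact: monicXsubC|apply: irreducible_size2|]; rewrite size_XsubC.
have [Q QS Q2] := repeated_mem nuS.
set m := count_mem Q S in Q2; set R := [seq P <- S | P != Q].
have muQR : mu = Q ^+ m * \prod_(P <- R) P by rewrite muE (prod_count_mem Q).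
have [monQ irrQ] := irrS Q QS.
have szQ : size Q = 2%N.
  apply/eqP; rewrite eqn_leq; apply/andP; split; last by case: irrQ.
  by apply: square_factor; rewrite muQR dvdp_mulr // dvdp_exp2l.
have irrR P : P \in R -> P \is monic /\ irreducible_poly P.
  by rewrite mem_filter => /andP[_ /irrS].
exists R, Q, 1%N, m; split => //; last by rewrite muln1 mulrC.
  rewrite /= mem_filter eqxx /=; apply: contraT => /repeated_mem[P PR P2].
  have [monP [P1 _]] := irrR P PR.
  have : (size (P * Q)%R <= 2)%N.
    apply: square_factor; rewrite exprMn mulrC muQR dvdp_mul ?dvdp_exp2l //.
    by rewrite (prod_count_mem P) dvdp_mulr // dvdp_exp2l.
  by rewrite size_mul ?monic_neq0 // szQ addn2 /= ltnNge P1.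
split => //; move: Q2; rewrite leq_eqVlt => /orP[/eqP <-//|].
rewrite leq_eqVlt => /orP[/eqP <-//|m4].
have : (size (Q ^+ 2)%R <= 2)%N.
  by apply: square_factor; rewrite -exprM muQR dvdp_mulr // dvdp_exp2l.
by rewrite expr2 size_mul ?monic_neq0 // szQ.
Qed.

End FactorShape.

(** * Presentations and Chinese remainders *)

Section Presentation.
Variable k : fieldType.

(* k[T]/(D) is isomorphic to C through T |-> z. *)
Definition presents (C : algType k) (z : C) (D : {poly k}) : Prop :=
  (forall p, horner_alg z p = 0 <-> D %| p) /\
  (forall y, exists p, horner_alg z p = y).

Lemma minpoly_presents (A : falgType k) (g : A) (mu : {poly k}) :
  generated_by g -> is_minpoly g mu -> presents g mu.
Proof.
by move=> /generated_byP Hg gmu; split=> // p; apply: minpoly_eq0P.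
Qed.

Lemma presents_minpoly (A : falgType k) (g : A) (mu : {poly k}) :
  mu \is monic -> presents g mu -> generated_by g /\ is_minpoly g mu.
Proof.
move=> monmu [mu0 surj]; split; first exact/generated_byP.
by split=> // [|q /mu0 //]; apply/mu0/dvdpp.
Qed.

Lemma presents_shift (C : algType k) (z : C) (D : {poly k}) (c : k) :
  presents z D -> presents (z + c%:A) (D \Po ('X - c%:P)).
Proof.
move=> [D0 surj].
have shiftE p : horner_alg (z + c%:A) p = horner_alg z (p \Po ('X + c%:P)).
  by rewrite horner_alg_comp rmorphD /= horner_algX horner_algC.
have backK p : (p \Po ('X + c%:P)) \Po ('X - c%:P) = p.
  by rewrite -comp_polyA comp_polyD comp_polyX comp_polyC subrK comp_polyXr.
have K p : (p \Po ('X - c%:P)) \Po ('X + c%:P) = p.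
  by rewrite -comp_polyA comp_polyB comp_polyX comp_polyC addrK comp_polyXr.
split=> [p|y]; last first.
  by have [p <-] := surj y; exists (p \Po ('X - c%:P)); rewrite shiftE K.
rewrite shiftE D0; split=> H.
  by rewrite -[p]backK; apply: dvdp_comp_poly.
by rewrite -[D]K; apply: dvdp_comp_poly.
Qed.

(** If [R = s * q], one factor vanishes at [z] because [L] is a field; [R] divides that factor, and
    degrees exclude [s] when [q] is not constant. *)
Lemma presents_irreducible (L : fieldExtType k) (z : L) (R : {poly k}) :
  presents z R -> irreducible_poly R.
Proof.
move=> [R0 _].
have Rn0 : R != 0.
  have [p p0 /R0 pz] := ex_annihilator z.
  by apply: contraNneq p0 => R00; rewrite R00 dvd0p in pz.
have R1 : (1 < size R)%N.
  rewrite ltn_neqAle size_poly_gt0 Rn0 andbT eq_sym; apply/negP.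
  rewrite -dvdp1 => /R0; rewrite rmorph1 => /eqP.
  by rewrite oner_eq0.
split=> // q q1 /[dup] qR /dvdpP[s RE].
have : horner_alg z (s * q) = 0 by rewrite -RE; apply/R0.
rewrite rmorphM /= => /eqP; rewrite mulf_eq0 => /orP[] /eqP /R0 Rdvd; last first.
  by rewrite /eqp qR Rdvd.
have [s0 q0] : s != 0 /\ q != 0.
  by apply/andP; rewrite -negb_or -mulf_eq0 -RE.
have := dvdp_leq s0 Rdvd; rewrite RE size_mul // leqNgt => /negP[].
have q2 : (1 < size q)%N by rewrite ltn_neqAle eq_sym q1 size_poly_gt0.
by rewrite -(ltn_predK q2) addnS /= -addn1 leq_add2l -ltnS (ltn_predK q2).
Qed.

Lemma ex_field_presentation (P : {poly k}) : irreducible_poly P ->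
  exists (L : fieldExtType k) (z : L), generated_by z /\ presents z P.
Proof.
move=> irrP; have [L _ [z rz genz]] := irredp_FAdjoin irrP.
exists L, z; split=> //.
have [mu zmu] := ex_minpoly z.
have zp := minpoly_presents genz zmu.
have muP : mu %| P by apply/zp.1/eqP.
have muE : mu %= P.
  by apply: irrP.2 => //; have [m1 _] := presents_irreducible zp; rewrite gtn_eqF.
by split=> [p|]; [rewrite -(eqp_dvdl _ muE); apply: zp.1|exact: zp.2].
Qed.

(** [{poly %/ h}] is the quotient by [mk_monic h], which defaults to ['X] unless [h] is monic and
    nonconstant; [0 < m] ensures that it is ['X^m]. *)
Lemma in_qpolyXn_eq0 (m : nat) (p : {poly k}) : (0 < m)%N ->
  in_qpoly 'X^m p = 0 <-> 'X^m %| p.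
Proof.
move=> m0; have mkE : mk_monic 'X^m = 'X^m :> {poly k}.
  by rewrite mk_monic_Xn prednK.
split=> [/(congr1 val) /=|Xp].
  by rewrite mkE -Pdiv.IdomainMonic.modpE ?monicXn // => /eqP.
apply: val_inj => /=; rewrite mkE -Pdiv.IdomainMonic.modpE ?monicXn //.
exact/eqP.
Qed.

Lemma in_qpolyK (h : {poly k}) (u : {poly %/ h}) : in_qpoly h (polyn u) = u.
Proof. by apply/val_inj/in_qpoly_small/size_mk_monic. Qed.

Lemma presents_qpolyX (m : nat) : (0 < m)%N ->
  presents ('qX : {poly %/ 'X^m : {poly k}}) 'X^m.
Proof.
move=> m0.
have hE p : horner_alg ('qX : {poly %/ 'X^m : {poly k}}) p = in_qpoly 'X^m p.
  by rewrite (poly_alg_initial (in_qpoly 'X^m)).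
split=> [p|y]; first by rewrite hE; apply: in_qpolyXn_eq0.
by exists (polyn y); rewrite hE in_qpolyK.
Qed.

(** The universal property of [k[T]/(mu)]. A polynomial representing [x] is picked by [xchoose]; the
    value is independent of the choice, since two representatives differ by a multiple of [mu]. *)
Lemma presents_lift (A C : algType k) (g : A) (z : C) (mu : {poly k}) :
  presents g mu -> (forall p, mu %| p -> horner_alg z p = 0) ->
  exists f : {lrmorphism A -> C}, forall p, f (horner_alg g p) = horner_alg z p.
Proof.
move=> [mu0 surj] zmu.
have surjb x : exists p, horner_alg g p == x.
  by have [p <-] := surj x; exists p.
pose f x := horner_alg z (xchoose (surjb x)).
have fE p : f (horner_alg g p) = horner_alg z p.
  rewrite /f; set q := xchoose _; apply/eqP; rewrite -subr_eq0 -rmorphB /=.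
  apply/eqP/zmu/mu0; rewrite rmorphB /=.
  by rewrite (eqP (xchooseP (surjb (horner_alg g p)))) subrr.
have flin : linear f.
  move=> a x y; have [p <-] := surj x; have [q <-] := surj y.
  by rewrite -horner_algZ -rmorphD /= !fE rmorphD /= horner_algZ.
have fmon : monoid_morphism f.
  split; first by rewrite -(rmorph1 (horner_alg g)) fE rmorph1.
  move=> x y; have [p <-] := surj x; have [q <-] := surj y.
  by rewrite -rmorphM !fE rmorphM.
pose fL := GRing.isLinear.Build k A C _ f flin.
pose fM := GRing.isMonoidMorphism.Build A C f fmon.
pose F : {lrmorphism A -> C} := HB.pack f fL fM.
by exists F.
Qed.

(** * Products of quotients by pairwise coprime polynomials *)

Section Product.
Variables (I : finType) (C : I -> algType k) (z : forall i, C i).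
Variable D : I -> {poly k}.
Hypothesis zD : forall i, presents (z i) (D i).
Hypothesis copD : forall i j, i != j -> coprimep (D i) (D j).

Lemma prod_dvdpP p : \prod_i D i %| p <-> forall i, D i %| p.
Proof.
split=> [dvp i|dvp]; first by apply: dvdp_trans dvp; rewrite (bigD1 i) ?dvdp_mulr.
by apply: prod_dvdp => [|i j _ _ /copD //|i _]; rewrite ?index_enum_uniq.
Qed.

Lemma horner_alg_targets (y : forall i, C i) :
  exists p, forall i, horner_alg (z i) p = y i.
Proof.
have /fin_all_exists[t tP] i : exists p, horner_alg (z i) p = y i.
  exact: (zD i).2.
have [p pt] := chinese_poly t copD.
exists p => i; rewrite -tP; apply/eqP; rewrite -subr_eq0 -rmorphB /=.
by apply/eqP/(zD i).1.
Qed.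

Variable A : algType k.

Lemma presents_prod_iso (g : A) : presents g (\prod_i D i) ->
  exists f : forall i, {lrmorphism A -> C i},
    (forall x y, (forall i, f i x = f i y) -> x = y) /\
    (forall y : forall i, C i, exists x, forall i, f i x = y i).
Proof.
move=> gD.
have /fin_all_exists[f fE] i : exists f : {lrmorphism A -> C i},
    forall p, f (horner_alg g p) = horner_alg (z i) p.
  by apply: (presents_lift gD) => p /prod_dvdpP dp; apply/(zD i).1/dp.
exists f; split=> [x y fxy|y]; last first.
  by have [p py] := horner_alg_targets y; exists (horner_alg g p) => i;
    rewrite fE py.
move: fxy; have [p <-] := gD.2 x; have [q <-] := gD.2 y => fpq.
apply/eqP; rewrite -subr_eq0 -rmorphB /=; apply/eqP/gD.1/prod_dvdpP => i.
by apply/(zD i).1; rewrite rmorphB /= -!fE fpq subrr.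
Qed.

(** The element [g] with components [z i] works: a polynomial kills it exactly when every [D i]
    divides it, and Chinese remainders reach every tuple of components. *)
Lemma prod_iso_presents (f : forall i, {lrmorphism A -> C i}) :
  (forall x y, (forall i, f i x = f i y) -> x = y) ->
  (forall y : forall i, C i, exists x, forall i, f i x = y i) ->
  exists g : A, presents g (\prod_i D i).
Proof.
move=> finj fsurj; have [g gz] := fsurj z.
have fE i p : f i (horner_alg g p) = horner_alg (z i) p.
  by rewrite horner_alg_fun gz.
exists g; split=> [p|y]; last first.
  have [p py] := horner_alg_targets (fun i => f i y).
  by exists p; apply: finj => i; rewrite fE py.
rewrite prod_dvdpP; split=> [p0 i|dvp].
  by apply/(zD i).1; rewrite -fE p0 rmorph0.
by apply: finj => i; rewrite fE rmorph0; apply/(zD i).1/dvp.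
Qed.

End Product.
End Presentation.

(** * Equivalence of the two structural descriptions *)

Lemma big_option (R : Type) (idx : R) (op : Monoid.com_law idx) (I : finType)
    (F : option I -> R) :
  \big[op/idx]_(o : option I) F o = op (F None) (\big[op/idx]_i F (Some i)).
Proof.
rewrite (bigD1 None) //=; congr (op _ _).
rewrite (reindex_omap Some id) => [|[i|] //].
by apply: eq_bigl => i; rewrite eqxx.
Qed.

(** A greedy choice along [r]: each new value avoids [s] and the values already taken. Outside [r]
    the choice is [u0]. *)
Lemma avoiding_choice (I T U : eqType) (F : I -> U -> T) (u0 : U) (r : seq I)
    (s : seq T) :
  (forall i (s : seq T), exists u, F i u \notin s) -> uniq r ->
  exists c : I -> U, uniq [seq F i (c i) | i <- r] /\
    {in r, forall i, F i (c i) \notin s}.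
Proof.
move=> avoid; elim: r => [_|i r IHr] /=; first by exists (fun=> u0).
move=> /andP[ir ur]; have [c [uc cs]] := IHr ur.
have [u] := avoid i (s ++ [seq F j (c j) | j <- r]).
rewrite mem_cat negb_or => /andP[us ur'].
pose c' j := if j == i then u else c j.
have c'E j : j \in r -> c' j = c j.
  by rewrite /c'; case: eqP => // -> /(negP ir).
have c'i : c' i = u by rewrite /c' eqxx.
exists c'; split.
  have -> : [seq F j (c' j) | j <- r] = [seq F j (c j) | j <- r].
    by apply/eq_in_map => j jr; rewrite c'E.
  by rewrite c'i ur'.
by move=> j; rewrite inE => /predU1P[->|jr]; rewrite ?c'i ?c'E ?cs.
Qed.

Section Shift.
Variable k : fieldType.
Hypothesis k_infinite : infinite_type k.

(** The translate of [R] by [c] vanishes at [x + c]. If it were in [s], then [x + c] would be a root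
    of [M], which has only finitely many roots in [L]. *)
Lemma shift_avoids (L : fieldExtType k) (x : L) (R : {poly k})
    (s : seq {poly k}) :
  presents x R -> exists c, (R \Po ('X - c%:P)) \notin s.
Proof.
move=> xR; pose M := \prod_(r <- s | r != 0) r.
have M0 : M != 0.
  by apply: (big_ind (fun q : {poly k} => q != 0)) => [|a b|//];
    [exact: oner_neq0|exact: mulf_neq0].
pose ML := map_poly (in_alg L) M.
have ML0 : ML != 0 by rewrite map_poly_eq0.
(* [size ML] exceeds the degree by one, so these translates of [x] cannot all be roots. *)
have [cs ucs szcs] := infinite_uniq_seq (size ML) k_infinite.
have [/allP allr|] := boolP (all (root ML) [seq x + c%:A | c <- cs]).
  have := max_poly_roots ML0 (introT allP allr); rewrite size_map szcs ltnn.
  rewrite map_inj_uniq ?ucs => [/(_ isT) //|c d /addrI /eqP].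
  rewrite -subr_eq0 -scalerBl scaler_eq0 oner_eq0 orbF subr_eq0.
  by move/eqP.
case/allPn=> _ /mapP[c _ ->] ncR; exists c; apply: contra ncR => cs'.
have xcR := presents_shift c xR.
have Rc0 : R \Po ('X - c%:P) != 0.
  have [p p0 /xcR.1 pz] := ex_annihilator (x + c%:A).
  by apply: contraNneq p0 => R00; rewrite R00 dvd0p in pz.
apply/eqP/xcR.1; rewrite /M.
by rewrite (big_rem _ cs') /= Rc0 dvdp_mulr.
Qed.

Lemma monic_shift (R : {poly k}) (c : k) :
  R \is monic -> R \Po ('X - c%:P) \is monic.
Proof.
rewrite !monicE => /eqP R1.
by rewrite lead_coef_comp ?size_XsubC // R1 lead_coefXsubC expr1n mulr1.
Qed.

(** Distinct monic irreducible polynomials are coprime, as Chinese remainders require; ['X] is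
    reserved for the factor [k[T]/(T^m)]. *)
Lemma distinct_presentations (n : nat) (L : 'I_n -> fieldExtType k) :
  (forall i, simple_ext (L i)) ->
  exists (z : forall i, L i) (D : 'I_n -> {poly k}),
    [/\ forall i, presents (z i) (D i),
        forall i, D i \is monic /\ irreducible_poly (D i),
        forall i, D i != 'X & injective D].
Proof.
move=> /fin_all_exists[x gx].
have /fin_all_exists[R xR] i : exists R, is_minpoly (x i) R by apply: ex_minpoly.
have xRp i : presents (x i) (R i) by apply: minpoly_presents.
have [c [uc cX]] := avoiding_choice (F := fun i c => R i \Po ('X - c%:P)) 0
  [:: 'X] (fun i s => shift_avoids s (xRp i)) (enum_uniq 'I_n).
have zD i := presents_shift (c i) (xRp i).
exists (fun i => x i + (c i)%:A), (fun i => R i \Po ('X - (c i)%:P)).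
split=> // [i|i|i j].
- split; last exact: presents_irreducible (zD i).
  by apply: monic_shift; case: (xR i).
- by have := cX i (mem_enum _ i); rewrite inE.
exact: (elimT (injectiveP _) uc).
Qed.

End Shift.

(** Conditions (2) and (3) are named here, so that the implications between them can be proved and
    composed separately. *)
Definition product_form (k : fieldType) (A : falgType k) : Prop :=
  exists (n : nat) (L : 'I_n -> fieldExtType k) (delta m : nat),
    [/\ forall i, simple_ext (L i), (delta <= 1)%N, (m == 2)%N || (m == 3)%N &
        if delta == 0%N then
          exists f : forall i, {lrmorphism A -> L i}, iso_prod f
        else
          exists (f : forall i, {lrmorphism A -> L i})
                 (h : {lrmorphism A -> {poly %/ 'X^m : {poly k}}}),
            iso_prod_ext f h].

Definition monogenic_form (k : fieldType) (A : falgType k) : Prop :=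
  exists g : A, generated_by g /\
    exists (Ps : seq {poly k}) (Q : {poly k}) (delta m : nat),
      [/\ (forall P, P \in Ps -> P \is monic /\ irreducible_poly P),
          [/\ Q \is monic, irreducible_poly Q & size Q = 2%N],
          uniq (Q :: Ps),
          (delta <= 1)%N /\ ((m == 2)%N || (m == 3)%N) &
          is_minpoly g (\prod_(P <- Ps) P * Q ^+ (m * delta))].

Section Equivalence.
Variables (k : fieldType) (A : falgType k).

(** The index [None] stands for the factor [k[T]/(T^m)], so that the lemmas on products apply to a
    single family of algebras. *)
Definition option_alg (n : nat) (L : 'I_n -> fieldExtType k) (B : algType k)
    (o : option 'I_n) : algType k :=
  if o is Some i then L i : algType k else B.

Definition option_elt (n : nat) (L : 'I_n -> fieldExtType k) (B : algType k)
    (z : forall i, L i) (b : B) (o : option 'I_n) : option_alg L B o :=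
  match o with Some i => z i | None => b end.

Definition option_poly (n : nat) (D : 'I_n -> {poly k}) (Q : {poly k})
    (o : option 'I_n) : {poly k} := if o is Some i then D i else Q.

Lemma option_poly_coprime (n : nat) (D : 'I_n -> {poly k}) (Q : {poly k})
    (m : nat) :
  (forall i, D i \is monic /\ irreducible_poly (D i)) ->
  Q \is monic -> irreducible_poly Q -> injective D -> (forall i, D i != Q) ->
  forall o o', o != o' -> coprimep (option_poly D (Q ^+ m) o)
                                   (option_poly D (Q ^+ m) o').
Proof.
move=> Dirr Qmon Qirr Dinj DQ.
have copDQ i : coprimep (D i) (Q ^+ m).
  have [mD iD] := Dirr i; apply: coprimep_expr.
  exact: irreducible_monic_coprime.
case=> [i|] [j|] //= ij; last by rewrite coprimep_sym.
have [mD iD] := Dirr i; have [mD' iD'] := Dirr j.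
by apply: irreducible_monic_coprime => //; apply: contraNneq ij => /Dinj ->.
Qed.

Lemma product_monogenic : infinite_type k ->
  product_form A -> monogenic_form A.
Proof.
move=> kinf [n [L [delta [m [Lsimple delta1 m23 iso]]]]].
have [z [D [zD Dirr DX Dinj]]] := distinct_presentations kinf Lsimple.
have X1 : size ('X : {poly k}) = 2%N by rewrite size_polyX.
have Xirr := irreducible_size2 X1.
have copD := @option_poly_coprime n D 'X m Dirr (monicX _) Xirr Dinj DX.
have monD : \prod_i D i \is monic by apply: monic_prod => i _; case: (Dirr i).
suff [g gD] : exists g : A, presents g (\prod_i D i * 'X ^+ (m * delta)).
  have [|geng gmin] := presents_minpoly _ gD.
    by rewrite rpredM // monicXn.
  exists g; split=> //.
  exists [seq D i | i <- enum 'I_n], 'X, delta, m; split=> //.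
  - by move=> P /mapP[i _ ->].
  - by split=> //; apply: monicX.
  - rewrite /= map_inj_uniq ?enum_uniq // andbT.
    by apply/mapP=> -[i _ Xi]; have := DX i; rewrite -Xi eqxx.
  by rewrite big_map big_enum.
move: iso; case: eqP => [->|/eqP d0] iso.
  have [f [finj fsurj]] := iso.
  rewrite muln0 expr0 mulr1.
  apply: (prod_iso_presents (C := fun i => L i : algType k) zD) finj fsurj.
  by move=> i j ij; apply: (copD (Some i) (Some j)).
have -> : delta = 1%N by case: delta d0 delta1 {iso} => [|[]].
have m0 : (0 < m)%N by case/orP: m23 => /eqP->.
have [f [h [fhinj fhsurj]]] := iso.
pose C := option_alg L ({poly %/ 'X^m : {poly k}} : algType k).
pose fh o : {lrmorphism A -> C o} :=
  match o return {lrmorphism A -> C o} with Some i => f i | None => h end.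
have [] := @prod_iso_presents k _ C (option_elt z ('qX : {poly %/ 'X^m}))
  (option_poly D 'X^m) _ copD A fh.
- by case=> [i|]; [exact: zD|exact: presents_qpolyX].
- move=> x y xy; apply: fhinj; last exact: (xy None).
  by move=> i; apply: (xy (Some i)).
- move=> y; have [x [xf xh]] := fhsurj (fun i => y (Some i)) (y None).
  by exists x; case.
move=> g; rewrite big_option /= mulrC => gD; exists g.
by rewrite muln1.
Qed.

Lemma monogenic_product : monogenic_form A -> product_form A.
Proof.
case=> g [geng [Ps [Q [delta [m [Psirr [Qmon Qirr szQ]]]]]]].
move=> /= /andP[QPs uPs] [delta1 m23] gmin.
have gD := minpoly_presents geng gmin.
pose n := size Ps; pose D (i : 'I_n) := Ps`_i.
have DPs i : D i \in Ps by apply: mem_nth.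
have /fin_all_exists[L Lz] i : exists (L : fieldExtType k) (z : L),
    generated_by z /\ presents z (D i).
  by apply: ex_field_presentation; case: (Psirr _ (DPs i)).
have /fin_all_exists[z /all_and2[zgen zD]] := Lz.
have DQ i : D i != Q by apply: contraNneq QPs => <-.
have Dinj : injective D.
  by move=> i j /eqP; rewrite nth_uniq // => /eqP/val_inj.
have copD m' := @option_poly_coprime n D Q m' (fun i => Psirr _ (DPs i)) Qmon
  Qirr Dinj DQ.
have prodD : \prod_(P <- Ps) P = \prod_i D i.
  by rewrite (big_nth 0) big_mkord.
exists n, L, delta, m; split=> // [i|]; first by exists (z i).
rewrite prodD in gD; move: gD; case: eqP => [->|/eqP d0].
  rewrite muln0 expr0 mulr1 => gD.
  apply: (presents_prod_iso (C := fun i => L i : algType k) zD) gD.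
  by move=> i j ij; apply: (copD 0%N (Some i) (Some j)).
have -> : delta = 1%N by case: delta d0 delta1 {gmin} => [|[]].
have m0 : (0 < m)%N by case/orP: m23 => /eqP->.
rewrite muln1 mulrC => gD.
(* Being monic and linear, [Q] is ['X - q]; hence ['qX + q] presents the quotient by ['X^m] with
   relation [Q ^+ m]. *)
have QE : Q = 'X - (- Q`_0)%:P.
  apply/polyP=> -[|[|i]]; rewrite coefB coefX coefC /= ?subr0 ?sub0r ?opprK //.
    by move/monicP: Qmon; rewrite /lead_coef szQ.
  by rewrite nth_default // szQ.
set q := - Q`_0 in QE.
have bQ := presents_shift q (presents_qpolyX k m0).
rewrite comp_Xn_poly -QE in bQ.
pose C := option_alg L ({poly %/ 'X^m : {poly k}} : algType k).
have [] := @presents_prod_iso k _ C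
  (option_elt z (('qX : {poly %/ 'X^m : {poly k}}) + q%:A))
  (option_poly D (Q ^+ m)) _ (copD m) A g.
- by case=> [i|]; [exact: zD|exact: bQ].
- by rewrite big_option.
move=> f [finj fsurj]; exists (fun i => f (Some i)), (f None); split.
  by move=> x y fxy fN; apply: finj; case.
move=> y b; have [x xf] := fsurj (option_elt y b).
by exists x; split=> [i|]; [exact: (xf (Some i))|exact: (xf None)].
Qed.

End Equivalence.

(** * Subalgebras containing the kernel of maps to fields *)

Section Retraction.
Variables (k : fieldType) (A : falgType k).
Hypothesis mulC : forall x y : A, x * y = y * x.
Variables (I : finType) (F : I -> fieldType).
Variable phi : forall i, {rmorphism A -> F i}.

Definition in_kernel (x : A) : Prop := forall i, phi i x = 0.

Variable B : {vspace A}.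
Hypothesis subB : is_subalgebra B.
Hypothesis kerB : forall x, in_kernel x -> x \in B.

(** A [B]-submodule whose intersection with [B] is trivial modulo the joint kernel. Once it spans
    [A] with [B], it is a complement of [B] modulo that kernel. *)
Definition transverse (M : {vspace A}) : Prop :=
  (B * M <= M)%VS /\ forall x, x \in B -> x \in M -> in_kernel x.

(* Take an idempotent f of B with f x outside M + B and f B minimal: then b f lies
   in the kernel whenever b f x lies in M + B, so M + B f x is still transverse. *)
Lemma transverse_extend_idem (M : {vspace A}) (x : A) : transverse M ->
  forall f, f \in B -> f * f = f -> f * x \notin (M + B)%VS ->
  exists M' : {vspace A}, transverse M' /\ (\dim M < \dim M')%N.
Proof.
move=> [BM MB] f; have [n] := ubnP (\dim (<[f]> * B)%VS).
elim: n f => // n IHn f; rewrite ltnS => le_n fB ff fx.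
have modMB c u : c \in B -> u \in (M + B)%VS -> c * u \in (M + B)%VS.
  move=> cB /memv_addP[m mM [b bB ->]]; rewrite mulrDr memv_add //.
    exact: (subvP BM _ (memv_mul cB mM)).
  exact: subalgM.
have [[b [bB bfx nbf]]|nex] :=
  classic (exists b, [/\ b \in B, b * f * x \in (M + B)%VS & ~ in_kernel (b * f)]).
  (* Outside the kernel [y] is not nilpotent, so its idempotent [w] is nonzero. As [w] is a multiple
     of [y], [w * x] lies in [M + B], and [f - w] can replace [f]. *)
  set y := b * f in bfx nbf.
  have yB : y \in B by apply: subalgM.
  have [v [j]] := fitting_idempotent y; set w := _ * y ^+ _ => /= -[ww yw].
  have cB : horner_alg y v * y ^+ j \in B.
    apply: subalgM => //; first exact: subalg_horner.
    by rewrite -(horner_algX y) -rmorphXn; apply: subalg_horner.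
  have wE : w = horner_alg y v * y ^+ j * y by rewrite /w exprSr mulrA.
  have wB : w \in B by rewrite wE; apply: subalgM.
  have wf : w * f = w by rewrite wE /y -!mulrA ff.
  have fw : f * w = w by rewrite mulC.
  have w0 : w != 0.
    apply/eqP=> w0; apply: nbf => i; move/(congr1 (phi i)): yw.
    rewrite w0 mulr0 rmorph0 rmorphXn => /esym/eqP.
    by rewrite expf_eq0 /= => /eqP.
  have wx : w * x \in (M + B)%VS.
    by rewrite wE -(mulrA _ y x); exact: (modMB _ _ cB bfx).
  apply: (IHn (f - w)).
  - apply: leq_trans le_n.
    have sub : (<[f - w]> * B <= <[f]> * B)%VS.
      apply/prodvP=> u c /vlineP[a ->] cB'.
      have -> : a *: (f - w) * c = f * (a *: (f - w) * c).
        by rewrite mulrA -scalerAr mulrBr ff fw.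
      apply: memv_mul; first exact: memv_line.
      by apply: subalgM => //; apply/memvZ/memvB.
    rewrite ltn_neqAle dimvS // andbT (dimv_leqif_eq sub).
    (* The inclusion is strict: [w] lies in [f B] and annihilates [(f - w) B], but [w * w = w] is
       nonzero. *)
    apply: contraNneq w0 => eqV.
    have wfB : w \in (<[f]> * B)%VS by rewrite -fw memv_mul ?memv_line.
    have : (<[f - w]> * B <= lker (amull w))%VS.
      apply/prodvP=> u c /vlineP[a ->] _; rewrite memv_ker lfunE /=.
      by rewrite mulrA -scalerAr mulrBr wf ww subrr scaler0 mul0r.
    rewrite eqV => /subvP /(_ w wfB); rewrite memv_ker lfunE /=.
    by rewrite ww.
  - exact: memvB.
  - by rewrite mulrBr !mulrBl ff wf fw ww subrr subr0.
  - apply: contra fx => fx; have := memvD fx wx.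
    by rewrite mulrBl subrK.
exists (M + B * <[f * x]>)%VS; split; [split|].
- rewrite prodvDr subv_add (subv_trans BM) ?addvSl //= prodvA.
  apply: subv_trans (addvSr _ _); apply: prodvSl.
  by case/andP: subB.
- move=> z zB /memv_addP[m mM [u]].
  rewrite -limg_amulr => /memv_imgP[b bB ->] zE.
  rewrite lfunE /= mulrA in zE.
  have kerbf : in_kernel (b * f).
    apply: NNPP => nk; apply: nex; exists b; split => //.
    have -> : b * f * x = - m + z by rewrite zE addKr.
    by rewrite memv_add // memvN.
  have kerbfx : in_kernel (b * f * x) by move=> i; rewrite rmorphM kerbf mul0r.
  have mB : m \in B.
    have -> : m = z - b * f * x by rewrite zE addrK.
    by rewrite memvB // kerB.
  by move=> i; rewrite zE rmorphD MB // kerbfx addr0.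
have sub := addvSl M (B * <[f * x]>).
rewrite ltn_neqAle dimvS // andbT (dimv_leqif_eq sub).
apply: contra fx => /eqP ->; apply: (subvP (addvSl _ _)).
apply: (subvP (addvSr _ _)).
by have := memv_mul (subalg1 subB) (memv_line (f * x)); rewrite mul1r.
Qed.

(** Starting from 0, a transverse [M] is enlarged as long as [B + M] is not [A]; each enlargement
    starts from the idempotent 1 and raises the dimension. *)
Lemma ex_transverse_complement :
  exists M, transverse M /\ (B + M)%VS = fullv.
Proof.
suff main n M : (\dim {: A} <= \dim M + n)%N -> transverse M ->
    exists M', transverse M' /\ (B + M')%VS = fullv.
  apply: (main (\dim {: A}) 0%VS); first exact: leq_addl.
  split=> [|x _]; first by rewrite prodv0 subvv.
  by rewrite memv0 => /eqP-> i; rewrite rmorph0.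
elim: n M => [|n IHn] M le_n tM.
  exists M; split=> //; apply/eqP; rewrite eqEdim subvf /=.
  by rewrite addn0 in le_n; apply: leq_trans le_n (dimvS (addvSr _ _)).
have [full|] := boolP (fullv <= B + M)%VS.
  by exists M; split=> //; apply/eqP; rewrite eqEsubv subvf.
case/subvPn=> x _ xMB.
have [||M' [tM' ltM]] := transverse_extend_idem (x := x) tM (subalg1 subB).
- by rewrite mulr1.
- by rewrite mul1r addvC.
by apply: (IHn M') => //; apply: leq_trans le_n _; rewrite addnS -addSn leq_add2r.
Qed.

(** Projection onto [B] along [M]. The sum [B + M] need not be direct, so the identities hold up to
    elements of [B] that lie in [M], hence in the kernel. *)
Lemma ex_retraction : exists rho : 'End(A),
  [/\ forall x, rho x \in B,
      forall x, x \in B -> in_kernel (rho x - x) &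
      forall b x, b \in B -> in_kernel (rho (b * x) - b * rho x)].
Proof.
have [M [[BM MB] full]] := ex_transverse_complement.
exists (addv_pi1 B M).
have rB x : addv_pi1 B M x \in B by apply: memv_pi1.
have rM x : x - addv_pi1 B M x \in M.
  have xF : x \in (B + M)%VS by rewrite full memvf.
  by rewrite -{1}(addv_pi1_pi2 xF) addrC addKr memv_pi2.
split=> // [x xB|b x bB]; apply: MB.
- exact: memvB.
- by rewrite -memvN opprB rM.
- by rewrite memvB // subalgM.
rewrite -(subrKA (b * x)) -opprB -mulrBr memvD ?memvN //.
by apply: (subvP BM); apply: memv_mul.
Qed.

End Retraction.

(** * Steinitz' argument: recovering a subalgebra from polynomial ideals *)

Section FunctionalOnPolynomials.
Variables (F : fieldType) (a : nat -> F).

(** The linear functional on [F[T]] that sends [T^j] to [a j]. *)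
Definition coef_functional (P : {poly F}) : F := \sum_(j < size P) P`_j * a j.

Lemma coef_functionalE n (P : {poly F}) :
  (size P <= n)%N -> coef_functional P = \sum_(j < n) P`_j * a j.
Proof.
move=> le_n; rewrite /coef_functional (big_ord_widen _ (fun j => P`_j * a j) le_n).
rewrite big_mkcond; apply: eq_bigr => j _; case: ltnP => // le_j.
by rewrite nth_default // mul0r.
Qed.

Lemma coef_functionalD (P Q : {poly F}) :
  coef_functional (P + Q) = coef_functional P + coef_functional Q.
Proof.
pose n := maxn (size P) (size Q).
rewrite !(@coef_functionalE n) ?leq_maxl ?leq_maxr ?size_polyD //.
by rewrite -big_split; apply: eq_bigr => j _; rewrite coefD mulrDl.
Qed.

Lemma coef_functional_monomial c l : coef_functional (c%:P * 'X^l) = c * a l.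
Proof.
rewrite (@coef_functionalE l.+1); last first.
  by rewrite mul_polyC (leq_trans (size_scale_leq _ _)) // size_polyXn.
rewrite (bigD1 ord_max) //= big1 => [|j jl]; last first.
  by rewrite coefCM coefXn -val_eqE /= in jl *; rewrite (negPf jl) mulr0 mul0r.
by rewrite coefCM coefXn eqxx mulr1 addr0.
Qed.

End FunctionalOnPolynomials.

Section Reduced.
Variables (k : fieldType) (A : falgType k) (g : A).
Hypothesis gen : generated_by g.
Variables (I : finType) (F : I -> fieldType).
Variable phi : forall i, {rmorphism A -> F i}.

(** The image of [q(T) - q(g)] in [F_i[T]]; scalars of [k] reach [F i] through [A]. *)
Definition relation_poly i (q : {poly k}) : {poly F i} :=
  map_poly (phi i \o in_alg A) q - (phi i (horner_alg g q))%:P.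

Definition relation_ideal (B : {vspace A}) i (P : {poly F i}) : Prop :=
  exists2 s : seq ({poly F i} * {poly k}),
    forall t, t \in s -> horner_alg g t.2 \in B &
    P = \sum_(t <- s) t.1 * relation_poly i t.2.

Lemma relation_idealD B i P Q :
  relation_ideal B P -> relation_ideal B Q -> @relation_ideal B i (P + Q).
Proof.
move=> [s sB ->] [r rB ->]; exists (s ++ r); last by rewrite big_cat.
by move=> t; rewrite mem_cat => /orP[/sB|/rB].
Qed.

Lemma relation_idealM B i R P :
  relation_ideal B P -> @relation_ideal B i (R * P).
Proof.
move=> [s sB ->]; exists [seq (R * t.1, t.2) | t <- s].
  by move=> _ /mapP[t /sB tB ->].
by rewrite big_map mulr_sumr; apply: eq_bigr => t _; rewrite mulrA.
Qed.

Lemma mem_relation_ideal (B : {vspace A}) i q :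
  horner_alg g q \in B -> relation_ideal B (relation_poly i q).
Proof.
move=> qB; exists [:: (1, q)]; first by move=> t; rewrite inE => /eqP->.
by rewrite big_seq1 mul1r.
Qed.

(** Let [rho] be a retraction onto [B]. The functional on [F_i[T]] sending [T^j] to the image of
    [rho (g ^+ j)] kills the relation ideal, hence [q(T) - q(g)]. So [rho] fixes [q(g)] modulo the
    kernel, which lies in [B]. *)
Lemma relation_idealP (B : {vspace A}) q : is_subalgebra B ->
  (forall x, in_kernel phi x -> x \in B) ->
  (forall i, relation_ideal B (relation_poly i q)) -> horner_alg g q \in B.
Proof.
move=> subB kerB qB.
have mulC x y : x * y = y * x := generated_commute x y gen.
have [rho [rhoB rho1 rhoM]] := ex_retraction mulC subB kerB.
pose Phi i := coef_functional (fun j => phi i (rho (g ^+ j))).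
have PhiD i P Q : Phi i (P + Q) = Phi i P + Phi i Q by apply: coef_functionalD.
have Phi_map i c l p : Phi i (c%:P * 'X^l * map_poly (phi i \o in_alg A) p) =
    c * phi i (rho (horner_alg g p * g ^+ l)).
  elim/poly_ind: p l => [|p b IHp] l.
    by rewrite !rmorph0 mulr0 mul0r linear0 rmorph0 mulr0 /Phi
       /coef_functional size_poly0 big_ord0.
  rewrite !rmorphD !rmorphM /= map_polyX map_polyC horner_algX horner_algC /=.
  have -> : c%:P * 'X^l * (map_poly (phi i \o in_alg A) p * 'X +
      (phi i b%:A)%:P) = c%:P * 'X^(l.+1) * map_poly (phi i \o in_alg A) p +
      (c * phi i b%:A)%:P * 'X^l by rewrite polyCM exprS; ring.
  rewrite PhiD IHp /Phi coef_functional_monomial mulrDl linearD rmorphD mulrDr.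
  by rewrite -!mulrA -exprS mulr_algl linearZ /= -(mulr_algl b (rho _)) rmorphM.
(* On [T^l (p(T) - p(g))] the functional is the image of [rho (p(g) g^l) - p(g) rho (g^l)], zero by
   [B]-linearity modulo the kernel. *)
have Phi_relation i R p :
    horner_alg g p \in B -> Phi i (R * relation_poly i p) = 0.
  move=> pB; suff main l : Phi i (R * 'X^l * relation_poly i p) = 0.
    by have := main 0%N; rewrite expr0 mulr1.
  elim/poly_ind: R l => [|R c IHR] l.
    by rewrite !mul0r /Phi /coef_functional size_poly0 big_ord0.
  have -> : (R * 'X + c%:P) * 'X^l * relation_poly i p =
     R * 'X^(l.+1) * relation_poly i p + c%:P * 'X^l * relation_poly i p.
    by rewrite exprS; ring.
  rewrite PhiD IHR add0r /relation_poly.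
  have -> : c%:P * 'X^l * (map_poly (phi i \o in_alg A) p
      - (phi i (horner_alg g p))%:P) =
      c%:P * 'X^l * map_poly (phi i \o in_alg A) p
      + (- (c * phi i (horner_alg g p)))%:P * 'X^l.
    by rewrite polyCN polyCM; ring.
  rewrite PhiD Phi_map /Phi coef_functional_monomial mulNr -mulrA -mulrBr.
  by rewrite -rmorphM -rmorphB rhoM // mulr0.
have Phi_ideal i P : relation_ideal B P -> Phi i P = 0.
  case=> s sB ->; rewrite big_seq.
  apply: (big_ind (fun Q => Phi i Q = 0)) => [|P1 P2 P10 P20|t /sB tB].
  - by rewrite /Phi /coef_functional size_poly0 big_ord0.
  - by rewrite PhiD P10 P20 addr0.
  - exact: Phi_relation.
have rho_q : in_kernel phi (rho (horner_alg g q) - horner_alg g q).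
  move=> i; have := Phi_ideal i _ (qB i); rewrite /relation_poly.
  have -> : map_poly (phi i \o in_alg A) q - (phi i (horner_alg g q))%:P =
      1%:P * 'X^0 * map_poly (phi i \o in_alg A) q
      + (- phi i (horner_alg g q))%:P * 'X^0.
    by rewrite polyCN expr0; ring.
  rewrite PhiD Phi_map /Phi coef_functional_monomial expr0 mul1r mulr1.
  have /eqP := rho1 1 (subalg1 subB) i.
  by rewrite rmorphB subr_eq0 rmorph1 => /eqP ->; rewrite mulr1 rmorphB.
by have := memvB (rhoB (horner_alg g q)) (kerB _ rho_q); rewrite subKr.
Qed.

(** [B] is coded by the monic generators of its relation ideals. They divide the image of the fixed
    polynomial [mu], and [relation_idealP] recovers [B] from them. *)
Lemma finitely_many_above_kernel :
  exists s : seq {vspace A}, forall B, is_subalgebra B ->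
    (forall x, in_kernel phi x -> x \in B) -> B \in s.
Proof.
have [mu mu0 mug] := ex_annihilator g.
have mu_phi0 i : map_poly (phi i \o in_alg A) mu != 0 by rewrite map_poly_eq0.
have /fin_all_exists[ds dsP] i : exists s : seq {poly F i}, forall d,
    d \is monic -> d %| map_poly (phi i \o in_alg A) mu -> d \in s.
  exact: monic_divisors_finite.
pose T := {dffun forall i, 'I_(size (ds i))}.
pose generates (B : {vspace A}) (t : T) := forall i,
  relation_ideal B (ds i)`_(t i) /\
  forall P, relation_ideal B P -> (ds i)`_(t i) %| P.
have [||s sP] := @finite_of_code _ T (fun B : {vspace A} => is_subalgebra B /\
  (forall x, in_kernel phi x -> x \in B)) generates (enum T).
- move=> B [subB kerB].
  (* Since [mu(g) = 0] lies in [B], the relation polynomial of [mu] is [mu] itself, mapped to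
     [F i]. *)
  have mu_rel i : relation_ideal B (map_poly (phi i \o in_alg A) mu).
    have := @mem_relation_ideal B i mu; rewrite mug mem0v => /(_ isT).
    by rewrite /relation_poly mug rmorph0 subr0.
  have /fin_all_exists[t tP] i : exists j : 'I_(size (ds i)),
      relation_ideal B (ds i)`_j /\
      forall P, relation_ideal B P -> (ds i)`_j %| P.
    have [d [mond Bd dvd]] := ideal_principal (@relation_idealD B i)
      (@relation_idealM B i) (mu_phi0 i) (mu_rel i).
    have dds := dsP i d mond (dvd _ (mu_rel i)).
    have lt_d : (index d (ds i) < size (ds i))%N by rewrite index_mem.
    by exists (Ordinal lt_d); rewrite /= nth_index.
  by exists [ffun i => t i]; rewrite ?mem_enum // => i; rewrite ffunE.
- have sub B B' t : is_subalgebra B' -> (forall x, in_kernel phi x -> x \in B') ->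
      generates B t -> generates B' t -> (B <= B')%VS.
    move=> subB' kerB' Bt B't; apply/subvP => x.
    have [q <-] := (generated_byP g).1 gen x => qB.
    apply: relation_idealP => // i.
    have /dvdpP[r ->] := (Bt i).2 _ (mem_relation_ideal i qB).
    by apply: relation_idealM; case: (B't i).
  move=> B B' t [subB kerB] [subB' kerB'] Bt B't.
  by apply/eqP; rewrite eqEsubv !(sub _ _ t).
by exists s => B subB kerB; apply: sP.
Qed.

End Reduced.

(** * Adding a truncated polynomial factor *)

Section TruncatedPolynomials.
Variables (k : fieldType) (m : nat).
Hypothesis m0 : (0 < m)%N.
Local Notation R := ({poly %/ 'X^m : {poly k}}).

Definition const_coef (u : R) : k := (polyn u)`_0.

Lemma in_qpoly_alg (c : k) : c%:A = in_qpoly 'X^m c%:P :> R.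
Proof. by rewrite -alg_polyC linearZ /= rmorph1. Qed.

Lemma const_coef_in_qpoly (p : {poly k}) : const_coef (in_qpoly 'X^m p) = p`_0.
Proof.
move uE: (in_qpoly 'X^m p) => u.
have : in_qpoly 'X^m (polyn u - p) = 0.
  by rewrite rmorphB /= in_qpolyK uE subrr.
move/(in_qpolyXn_eq0 _ m0)/dvdpP=> [q qE]; apply/eqP; rewrite /const_coef.
by rewrite -subr_eq0 -coefB qE coefMXn m0.
Qed.

Lemma const_coef_monoid_morphism : monoid_morphism const_coef.
Proof.
split=> [|u v]; first by rewrite /const_coef /= coefC.
have := const_coef_in_qpoly (polyn u * polyn v).
by rewrite rmorphM /= !in_qpolyK coef0M.
Qed.

Hypothesis m3 : (m <= 3)%N.

Lemma qpolyX_cube : ('qX : R) ^+ 3 = 0.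
Proof.
rewrite /qpolyX -rmorphXn; apply/(in_qpolyXn_eq0 _ m0).
exact: dvdp_exp2l.
Qed.

Lemma const_coef0_span (u : R) : const_coef u = 0 ->
  exists a b, u = a *: 'qX + b *: 'qX ^+ 2.
Proof.
(* Remainders have size at most 3; for [m = 2] the last coefficient is the default value 0, so both
   values of [m] are treated alike. *)
move=> u0; exists (polyn u)`_1, (polyn u)`_2.
rewrite -[LHS]in_qpolyK /qpolyX -rmorphXn -!linearZ -linearD /=.
congr (in_qpoly _ _); apply/polyP=> i.
rewrite coefD !coefZ coefX coefXn.
case: i => [|[|[|i]]]; rewrite /= ?mulr0 ?mulr1 ?add0r ?addr0 //.
apply: nth_default; apply: leq_trans (size_npoly u) _.
by rewrite mk_monic_Xn prednK // size_polyXn /= (leq_trans m3).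
Qed.

Lemma const_coef0_cube (u : R) : const_coef u = 0 -> u ^+ 3 = 0.
Proof.
move=> /const_coef0_span[a [b ->]].
have -> : a *: 'qX + b *: 'qX ^+ 2 = ('qX : R) * (a%:A + b *: 'qX).
  by rewrite mulrDr -!scalerAr mulr1 -expr2.
by rewrite exprMn qpolyX_cube mul0r.
Qed.

End TruncatedPolynomials.

(** * Algebras with a factor [k[T]/(T^m)] *)

Section NilpotentFactor.
Variables (k : fieldType) (A : falgType k) (n : nat).
Variables (L : 'I_n -> fieldExtType k) (m : nat).
Hypotheses (m0 : (0 < m)%N) (m3 : (m <= 3)%N).
Local Notation R := ({poly %/ 'X^m : {poly k}}).
Variables (f : forall i, {lrmorphism A -> L i}) (h : {lrmorphism A -> R}).
Hypothesis fh_inj : forall x y : A,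
  (forall i, f i x = f i y) -> h x = h y -> x = y.
Hypothesis fh_surj : forall (y : forall i, L i) (z : R),
  exists x : A, (forall i, f i x = y i) /\ h x = z.
Variable g : A.
Hypothesis gen : generated_by g.

Let residue_field (o : option 'I_n) : fieldType :=
  if o is Some i then L i : fieldType else k.

Lemma ex_residue : exists phi : forall o, {rmorphism A -> residue_field o},
  (forall i x, phi (Some i) x = f i x) /\
  (forall x, phi None x = const_coef (h x)).
Proof.
pose c (x : A) : k := const_coef (h x).
have cadd : zmod_morphism c by move=> x y; rewrite /c rmorphB /const_coef /= coefB.
have cmul : monoid_morphism c.
  have [c1 cM] := const_coef_monoid_morphism k m0.
  by split=> [|x y]; rewrite /c ?rmorph1 ?rmorphM ?c1 ?cM.
pose cA := GRing.isZmodMorphism.Build A k c cadd.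
pose cM := GRing.isMonoidMorphism.Build A k c cmul.
pose C : {rmorphism A -> k} := HB.pack c cA cM.
by exists (fun o => match o return {rmorphism A -> residue_field o} with
                    | Some i => f i | None => C end).
Qed.

(** The joint kernel of the residue maps, that is, the nilradical of [A]. *)
Definition radical_elt (x : A) : Prop :=
  (forall i, f i x = 0) /\ const_coef (h x) = 0.

Let mulC (x y : A) : x * y = y * x. Proof. exact: generated_commute gen. Qed.

(** [eta] is 0 in every field and the class of [T] in the last factor; for [m = 2] its square is
    already 0. *)
Lemma ex_radical_span : exists eta : A, eta ^+ 3 = 0 /\
  forall x, radical_elt x <-> x \in (<[eta]> + <[eta ^+ 2]>)%VS.
Proof.
have [eta [feta heta]] := fh_surj (fun=> 0) 'qX.
have h0 : const_coef (h eta) = 0.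
  by rewrite heta /qpolyX const_coef_in_qpoly // coefX.
exists eta; split.
  apply: fh_inj => [i|]; rewrite !(rmorphXn, rmorph0) /=.
    by rewrite feta expr0n.
  by rewrite heta qpolyX_cube.
move=> x; split=> [[fx hx]|/memv_addP[_ /vlineP[a ->] [_ /vlineP[b ->] ->]]].
  have [a [b hE]] := const_coef0_span m0 m3 hx.
  have -> : x = a *: eta + b *: eta ^+ 2.
    apply: fh_inj => [i|]; rewrite rmorphD /= !linearZ /= rmorphXn /=.
      by rewrite fx feta expr0n !scaler0 addr0.
    by rewrite heta.
  by rewrite memv_add // memvZ // memv_line.
split=> [i|].
  rewrite rmorphD /= !linearZ /= rmorphXn /= feta.
  by rewrite expr0n !scaler0 addr0.
have -> : a *: eta + b *: eta ^+ 2 = eta * (a%:A + b *: eta).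
  by rewrite mulrDr -!scalerAr mulr1 expr2.
have [_ cM] := const_coef_monoid_morphism k m0.
by rewrite rmorphM cM h0 mul0r.
Qed.

Lemma radical_eq0 x c : radical_elt x -> h x = c%:A -> x = 0.
Proof.
move=> [fx hx] hc; apply: fh_inj => [i|]; rewrite rmorph0 ?fx //.
move: hx; rewrite hc in_qpoly_alg const_coef_in_qpoly // coefC /= => ->.
by rewrite rmorph0.
Qed.

(* The idempotent of k[x - c], c the residue of x in the local factor, that
   vanishes exactly on the factors where x - c is invertible kills all field
   components of x - c but not its nilpotent one. *)
Lemma subalg_radical_part (B : {vspace A}) x : is_subalgebra B -> x \in B ->
  exists nu, [/\ nu \in B, radical_elt nu & exists c, h (x - nu) = c%:A].
Proof.
move=> subB xB; set c := const_coef (h x); set y := x - c%:A.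
have yB : y \in B by rewrite memvB // subalg_alg.
have hy : h y = h x - c%:A by rewrite rmorphB /= rmorph_alg.
have hy0 : const_coef (h y) = 0.
  rewrite hy in_qpoly_alg.
  have -> : h x - in_qpoly 'X^m c%:P = in_qpoly 'X^m (polyn (h x) - c%:P).
    by rewrite rmorphB /= in_qpolyK.
  by rewrite const_coef_in_qpoly // coefB coefC subrr.
have [v [j]] := fitting_idempotent y; set w := _ * y ^+ _ => /= -[ww yw].
have wB : w \in B.
  by apply: subalgM => //; [|rewrite -(horner_algX y) -rmorphXn];
    apply: subalg_horner.
(* The idempotent [w] equals its cube, which contains a power of [y ^+ 3], and the nilpotent [h y]
   has cube zero. *)
have hw : h w = 0.
  have wE : w = w ^+ 3 by rewrite !exprS expr0 mulr1 !ww.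
  rewrite wE rmorphXn /w rmorphM rmorphXn exprMn -exprM mulnC exprM.
  by rewrite (const_coef0_cube m0 m3 hy0) expr0n mulr0.
have fnu i : f i (y * (1 - w)) = 0.
  rewrite rmorphM /= [f i (1 - w)]rmorphB /= rmorph1.
  have [->|fy] := eqVneq (f i y) 0.
    by rewrite mul0r.
  have fyw : f i y ^+ j.+1 * f i w = f i y ^+ j.+1 * 1.
    by rewrite -rmorphXn -rmorphM yw mulr1.
  by rewrite (mulfI (expf_neq0 _ fy) fyw) subrr mulr0.
have hnu : h (y * (1 - w)) = h y.
  by rewrite rmorphM /= [h (1 - w)]rmorphB /= rmorph1 hw subr0 mulr1.
exists (y * (1 - w)); split.
- by apply: subalgM => //; rewrite memvB // subalg1.
- by split=> //; rewrite hnu.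
- by exists c; rewrite rmorphB /= hnu hy opprB addrC subrK.
Qed.

(** [B] is coded by [B + N], a subalgebra containing the joint kernel [N], and by [B :&: N], for
    which three values are possible. *)
Lemma nilpotent_factor_finite : finitely_many_subalgebras A.
Proof.
have [phi [phiS phiN]] := ex_residue.
have kerE x : in_kernel phi x <-> radical_elt x.
  split=> [px|[fx hx]].
    by split=> [i|]; rewrite -?phiS -?phiN px.
  by case=> [i|]; rewrite ?phiS ?phiN ?fx.
have [s sP] := finitely_many_above_kernel gen phi.
have [eta [eta3 etaP]] := ex_radical_span.
pose N := (<[eta]> + <[eta ^+ 2]>)%VS.
have NP x : radical_elt x <-> x \in N by apply: etaP.
have mulN x y : y \in N -> x * y \in N.
  move=> /NP/kerE ky; apply/NP/kerE => o; by rewrite rmorphM ky mulr0.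
have etaN : eta \in N by rewrite memvE addvSl.
have eta2N : eta ^+ 2 \in N by rewrite memvE addvSr.
have [||r rP] := @finite_of_code {vspace A} ({vspace A} * {vspace A})%type
  (fun B => is_subalgebra B) (fun B t => t = ((B + N)%VS, (B :&: N)%VS))
  [seq (U, W) | U <- s, W <- [:: 0%VS; <[eta ^+ 2]>%VS; N]].
- move=> B subB; exists ((B + N)%VS, (B :&: N)%VS) => //.
  apply/allpairsP; exists ((B + N)%VS, (B :&: N)%VS); split=> //=.
    apply: sP => [|x /kerE/NP xN]; last by apply: (subvP (addvSr _ _)).
    apply/andP; split; first by apply: (subvP (addvSl _ _)); apply: subalg1.
    apply/prodvP=> _ _ /memv_addP[b bB [x xN ->]] /memv_addP[b' b'B [x' x'N ->]].
    rewrite mulrDl mulrDr -addrA memv_add //; first exact: subalgM.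
    by apply: memvD; [|rewrite mulC]; apply: mulN.
  set W := (B :&: N)%VS; rewrite !inE.
  have [W2|] := boolP (W <= <[eta ^+ 2]>)%VS.
    have [->|] := eqVneq W 0%VS; first by [].
    rewrite -vpick0 => v0; apply/or3P; apply: Or32; rewrite eqEsubv W2 /=.
    have /vlineP[a vE] := subvP W2 _ (memv_pick W).
    have a0 : a != 0 by apply: contraNneq v0 => a0; rewrite vE a0 scale0r.
    have := memvZ a^-1 (memv_pick W).
    by rewrite vE scalerA mulVf // scale1r memvE.
  (* Here [y = a eta + b eta^2] with [a] nonzero. Then [y * y] is a nonzero multiple of [eta^2], so
     [B] contains [eta^2] and therefore [eta]. *)
  case/subvPn=> y; rewrite memv_cap => /andP[yB yN] y2.
  have /memv_addP[_ /vlineP[a ->] [_ /vlineP[b ->] yE]] := yN.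
  have a0 : a != 0.
    apply: contraNneq y2 => a0; rewrite yE a0 scale0r add0r.
    by rewrite memvZ // memv_line.
  have yy : y * y = (a * a) *: eta ^+ 2.
    have e3 : eta * eta ^+ 2 = 0 by rewrite -exprS.
    have e3' : eta ^+ 2 * eta = 0 by rewrite -exprSr.
    have e4 : eta ^+ 2 * eta ^+ 2 = 0 by rewrite exprS expr1 -mulrA e3 mulr0.
    rewrite yE mulrDl !mulrDr -!scalerAl -!scalerAr e3 e3' e4 -expr2.
    by rewrite !scaler0 !addr0 scalerA.
  have e2W : eta ^+ 2 \in W.
    rewrite memv_cap eta2N andbT.
    have := memvZ (a * a)^-1 (subalgM subB yB yB).
    by rewrite yy scalerA mulVf ?scale1r // mulf_neq0.
  have eW : eta \in W.
    have yW : y \in W by rewrite memv_cap yB.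
    have := memvZ a^-1 (memvB yW (memvZ b e2W)).
    by rewrite yE addrK scalerA mulVf // scale1r.
  apply/or3P; apply: Or33; rewrite eqEsubv capvSr /= subv_add.
  by rewrite -!memvE eW.
- have sub (B B' : {vspace A}) : is_subalgebra B -> is_subalgebra B' ->
      (B + N = B' + N)%VS -> (B :&: N = B' :&: N)%VS -> (B <= B')%VS.
    move=> subB subB' eqD eqI; apply/subvP=> x xB.
    have /memv_addP[x' x'B [d dN xE]] : x \in (B' + N)%VS.
      by rewrite -eqD; apply: (subvP (addvSl _ _)).
    have [nu [nuB nuR [c hc]]] := subalg_radical_part subB xB.
    have [nu' [nuB' nuR' [c' hc']]] := subalg_radical_part subB' x'B.
    have nuI : nu \in B' by have : nu \in (B :&: N)%VS;
      [rewrite memv_cap nuB; apply/NP | rewrite eqI memv_cap => /andP[]].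
    (* Both [x - nu] and [x' - nu'] are scalars in the last factor. Hence [d - (nu - nu')] is a
       nilpotent element whose last component is a scalar, so it is 0. *)
    have dE : d = nu - nu'.
      apply/eqP; rewrite -subr_eq0; apply/eqP.
      apply: (@radical_eq0 _ (c - c')).
        by apply/NP; rewrite !memvB //; apply/NP.
      have -> : d - (nu - nu') = (x - nu) - (x' - nu').
        by rewrite [in RHS]opprD addrACA -opprD xE [x' + d]addrC addrK.
      by rewrite rmorphB /= hc hc' scalerBl.
    by rewrite xE dE memvD // memvB.
  move=> B B' t subB subB' -> eqBB'.
  have [/= eqD eqI] := (congr1 fst eqBB', congr1 snd eqBB').
  by apply/eqP; rewrite eqEsubv; apply/andP; split; apply: sub.
by exists r.
Qed.

End NilpotentFactor.

Lemma product_finite (k : fieldType) (A : falgType k) : infinite_type k ->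
  product_form A -> finitely_many_subalgebras A.
Proof.
move=> kinf prodA; have [g [gen _]] := product_monogenic kinf prodA.
have [n [L [delta [m [_ _ m23]]]]] := prodA.
case: eqP => _ => [[f [finj _]]|[f [h [fhinj fhsurj]]]].
  (* The maps to the fields are jointly injective, so the kernel is 0 and lies in every
     subalgebra. *)
  have [s sP] := finitely_many_above_kernel gen
    (fun i => f i : {rmorphism A -> (L i : fieldType)}).
  exists s => B subB; apply: sP => // x kx.
  have -> : x = 0 by apply: finj => i; rewrite rmorph0; apply: kx.
  exact: mem0v.
have [m0 m3] : (0 < m)%N /\ (m <= 3)%N by case/orP: m23 => /eqP ->.
exact: (nilpotent_factor_finite m0 m3 fhinj fhsurj gen).
Qed.

Unset Implicit Arguments.
Set Strict Implicit.

Theorem theorem3p12 (k : fieldType) (k_infinite : infinite_type k)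
    (A : falgType k) :
  [<-> finitely_many_subalgebras A;
       exists (n : nat) (L : 'I_n -> fieldExtType k) (delta m : nat),
         [/\ forall i, simple_ext (L i), (delta <= 1)%N, (m == 2)%N || (m == 3)%N &
             if delta == 0%N then
               exists f : forall i, {lrmorphism A -> L i}, iso_prod f
             else
               exists (f : forall i, {lrmorphism A -> L i})
                      (h : {lrmorphism A -> {poly %/ 'X^m : {poly k}}}),
                 iso_prod_ext f h];
       exists g : A, generated_by g /\
         exists (Ps : seq {poly k}) (Q : {poly k}) (delta m : nat),
           [/\ (forall P, P \in Ps -> P \is monic /\ irreducible_poly P),
               [/\ Q \is monic, irreducible_poly Q & size Q = 2%N],
               uniq (Q :: Ps),
               (delta <= 1)%N /\ ((m == 2)%N || (m == 3)%N) &
               is_minpoly g (\prod_(P <- Ps) P * Q ^+ (m * delta))]].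
Proof.
(* The implications form the cycle (1), (2), (3), (1); the first passes through (3) and the last
   through (2). *)
tfae.
- move=> finA; apply: monogenic_product.
  have [g gen] := ex_generator k_infinite finA.
  have [mu gmu] := ex_minpoly g.
  have [mon_mu _ _] := gmu.
  have [Ps [Q [delta [m [irr linQ uni dm muE]]]]] := minpoly_shape k_infinite
    mon_mu (fun E => minpoly_square_factor k_infinite finA gmu).
  exists g; split=> //; exists Ps, Q, delta, m; split=> //.
  by rewrite -muE.
- exact: product_monogenic.
- by move=> /monogenic_product; apply: product_finite.
Qed.
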